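(* For every trie $\mathcal T$ and every integer $k\ge 0$, the number $r$ of XBWT runs satisfies $r\le \mathcal H^{wc}_k(\mathcal T)+\sigma^{k+1}$.
   Context: A trie $\mathcal T=(V,E)$ is a rooted tree with $n$ nodes whose edges are labeled with characters of $\Sigma=\{1,\dots,\sigma\}$, totally ordered by $\prec$, such that the edges leaving any node carry pairwise distinct labels. $\pi(\hat u)$ denotes the parent of node $\hat u$, with the convention $\pi(\text{root})=\text{root}$. $\lambda(\hat u)$ is the label of the edge entering $\hat u$; for the root $\lambda=\#$, where $\#$ is the $\prec$-smallest character of $\Sigma$ and labels no edge. Every character of $\Sigma$ is $\lambda(\hat u)$ for some node. $out(\hat u)$ is the set of labels of edges leaving $\hat u$. Nodes are sorted co-lexicographically: $\hat u<\hat v$ iff the root-to-node label string $\lambda(\text{root})\cdots\lambda(\hat u)$ precedes $\lambda(\text{root})\cdots\lambda(\hat v)$ when strings are compared right-to-left with $\prec$; let $\hat u_1<\dots<\hat u_n$ be the sorted nodes. For $c\in\Sigma$ and $1\le i\le n$, $i$ is a $c$-run break if $c\in out(\hat u_i)$ and either $i=n$ or $c\notin out(\hat u_{i+1})$; $r$ is the total number of pairs $(i,c)$ such that $i$ is a $c$-run break. Contexts: $\pi_0[\hat u]=\varepsilon$, $\pi_1[\hat u]=\lambda(\hat u)$, and $\pi_k[\hat u]=\pi_{k-1}[\pi(\hat u)]\cdot\lambda(\hat u)$ for $k>1$. For a finite sequence $X=X_1,\dots,X_{n'}$ of subsets of $\Sigma$ with $n'_c=|\{i: c\in X_i\}|$,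 the zero-order worst-case entropy is $\mathcal H^{wc}(X)=\sum_{c\in\Sigma}\log_2\binom{n'}{n'_c}$ (and $0$ for the empty sequence). For $\rho\in\Sigma^k$, $cover(\rho)$ is the sequence of sets $out(\hat u_i)$ over all $i$ with $\pi_k[\hat u_i]=\rho$. The $k$-th order worst-case entropy is $\mathcal H^{wc}_k(\mathcal T)=\sum_{\rho\in\Sigma^k}\mathcal H^{wc}(cover(\rho))$. *)

(* Defs.v *)
From HB Require Import structures.
From mathcomp Require Import all_boot all_order all_algebra.
From mathcomp Require Import reals exp.

Set Implicit Arguments.
Unset Strict Implicit.
Unset Printing Implicit Defensive.

Import Order.TTheory GRing.Theory Num.Theory.

Local Open Scope ring_scope.

(* Every non-root node v carries the edge (trie_parent v, v), labeled
   trie_label v; the edges of the tree are exactly these, so its shape is given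
   by the parent function alone. The alphabet is an arbitrary finite totally
   ordered type, sigma being its cardinality; the character # is
   trie_label trie_root. *)
Record trie (d : Order.disp_t) (Sigma : finOrderType d) := Trie {
  trie_node : finType;
  trie_root : trie_node;
  trie_parent : trie_node -> trie_node;
  trie_label : trie_node -> Sigma;
  trie_parent_root : trie_parent trie_root = trie_root;
  trie_rooted : forall u, exists m, iter m trie_parent u == trie_root;
  trie_label_root_min : forall c, (trie_label trie_root <= c)%O;
  trie_label_root_edge :
    forall u, u != trie_root -> trie_label u != trie_label trie_root;
  trie_deterministic : forall u v, u != trie_root -> v != trie_root ->
    trie_parent u = trie_parent v -> trie_label u = trie_label v -> u = v;
  trie_label_surj : forall c, exists u, trie_label u = c
}.

Arguments trie_root {d Sigma t}.
Arguments trie_parent {d Sigma t} _.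
Arguments trie_label {d Sigma t} _.
Arguments trie_rooted {d Sigma} t _.

Section TrieDefs.
Context {d : Order.disp_t} {Sigma : finOrderType d} (T : trie Sigma).
Implicit Types (u v : trie_node T) (c : Sigma) (k : nat).

Definition out u : {set Sigma} :=
  [set trie_label v | v : trie_node T & (v != trie_root) && (trie_parent v == u)].

Definition depth u : nat := ex_minn (trie_rooted T u).

Definition root_string u : seq Sigma :=
  rev [seq trie_label (iter i trie_parent u) | i <- iota 0 (depth u).+1].

Definition colex_le u v : bool :=
  (rev (root_string u) <= rev (root_string v) :> seqlexi Sigma)%O.

(* Distinct nodes have distinct root-to-node strings, so colex_le is a total
   order on nodes and this sequence is the unique co-lexicographic
   enumeration. *)
Definition sorted_nodes : seq (trie_node T) :=
  sort colex_le (enum (trie_node T)).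

(* Positions are numbered from 0 here, so the last one is n - 1. *)
Definition node_at (i : nat) : trie_node T := nth trie_root sorted_nodes i.

Definition run_break c (i : 'I_#|trie_node T|) : bool :=
  (c \in out (node_at i)) &&
  ((i.+1 == #|trie_node T|) || (c \notin out (node_at i.+1))).

Definition num_runs : nat :=
  #|[set p : 'I_#|trie_node T| * Sigma | run_break p.2 p.1]|.

(* The k-th order context; for k = 1 the recursion gives the one-letter string
   trie_label u. *)
Fixpoint ctx k u : seq Sigma :=
  if k is k'.+1 then rcons (ctx k' (trie_parent u)) (trie_label u) else [::].

Definition cover k (rho : k.-tuple Sigma) : seq {set Sigma} :=
  [seq out u | u <- sorted_nodes & ctx k u == rho].

End TrieDefs.

Definition log2 (R : realType) (x : R) : R := ln x / ln 2.

(* On the empty sequence every term is log2 'C(0, 0) = 0. *)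
Definition Hwc (R : realType) (Sigma : finType) (X : seq {set Sigma}) : R :=
  \sum_(c : Sigma)
    log2 ('C(size X, count (fun A : {set Sigma} => c \in A) X))%:R.

Definition Hwck (R : realType) (d : Order.disp_t) (Sigma : finOrderType d)
    (T : trie Sigma) (k : nat) : R :=
  \sum_(rho : k.-tuple Sigma) Hwc R (cover T rho).

(* Main.v *)
(** Contexts of length [k] are monotone for the co-lexicographic order, so the
    nodes with a given context [rho] are consecutive among the sorted nodes.
    Cutting the sorted sequence at the borders between contexts can only create
    run breaks, and within a block of [m] nodes, [t] of which have an outgoing
    [c], there are at most [1 + log2 'C(m, t)] breaks: exchanging the two bits
    of any subset of the factors [10] of the indicator word of [c] yields
    distinct words of length [m] and weight [t]. Summing the extra [1] over all
    pairs [(rho, c)] gives [sigma ^ k.+1]. *)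

Require Import Defs.
From mathcomp Require Import all_boot all_order all_algebra.
From mathcomp Require Import reals exp.

Set Implicit Arguments.
Unset Strict Implicit.
Unset Printing Implicit Defensive.

Import Order.TTheory GRing.Theory Num.Theory.

(** Counts each maximal run of [true] at its last position; the default [false] of [head] closes a
    run that reaches the end of the word, as the clause for the last node does in [run_break]. *)
Fixpoint runs (s : seq bool) : nat :=
  if s is b :: s' then (b && ~~ head false s') + runs s' else 0.

Lemma runsE (s : seq bool) :
  runs s = \sum_(i < size s) (nth false s i && ~~ nth false s i.+1).
Proof.
elim: s => [|b s IHs] /=; first by rewrite big_ord0.
by rewrite big_ord_recl IHs /= nth0.
Qed.

(** Prefixing 10 or 01 to a word of length [m] and weight [t] gives two disjoint families of
    words. *)
Lemma double_bin_leq (m t : nat) : 2 * 'C(m, t) <= 'C(m.+2, t.+1).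
Proof.
by rewrite binS mul2n -addnn leq_add // ?leq_bin2l // binS leq_addl.
Qed.

(** A final run of ones is followed by no 0 to exchange with; the factor 2 pays for it, with
    equality at [[:: true]]. *)
Lemma exp2_runs_leq (s : seq bool) :
  2 ^ runs s <= 2 * 'C(size s, count id s).
Proof.
(* The first two bits are 11, 10, 01 or 00. Only 10 holds a break at its first bit, and is removed
   whole; otherwise dropping one bit keeps [runs] and cannot raise the binomial. *)
have [n] := ubnP (size s); elim: n s => // n IHn [|[] [|[] s]] //= /ltnSE len_s.
- by have /= := IHn (true :: s) len_s => /leq_trans; apply;
    rewrite !add1n leq_mul2l [leqRHS]binS leq_addl.
- have len_s' : size s < n by exact: ltnW.
  rewrite !add0n add1n expnS leq_mul2l /=.
  exact: leq_trans (IHn s len_s') (double_bin_leq _ _).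
- have /= := IHn (true :: s) len_s => /leq_trans; apply.
  by rewrite !add0n leq_mul2l leq_bin2l.
- have /= := IHn (false :: s) len_s => /leq_trans; apply.
  by rewrite !add0n leq_mul2l leq_bin2l.
Qed.

Lemma runs_leq_sum_fibers (V : Type) (K : finType) (leK : rel K)
    (f : V -> K) (P : pred V) (s : seq V) :
  transitive leK -> antisymmetric leK -> sorted (relpre f leK) s ->
  runs (map P s) <= \sum_(x : K) runs [seq P v | v <- s & f v == x].
Proof.
move=> leK_trans leK_anti; elim: s => [|u s IHs] //= path_s.
have {IHs} := IHs (path_sorted path_s).
rewrite !(bigD1 (f u) (P := xpredT)) //= eqxx /= -addnA => IHs.
(* Adding [u] in front changes only the fiber of [f u]. *)
have -> : \sum_(x | x != f u)
    runs [seq P v | v <- if f u == x then u :: [seq v <- s | f v == x]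
                         else [seq v <- s | f v == x]] =
  \sum_(x | x != f u) runs [seq P v | v <- s & f v == x].
  by apply: eq_bigr => x; rewrite eq_sym => /negPf ->.
apply: leq_add IHs.
case: s path_s => [|v s] //= /andP[le_uv path_s].
(* If the key changes after [u], sortedness prevents it from returning, so [u] is alone in its fiber
   and a break there as soon as [P u] holds. *)
case: eqP => //= ne_vu; suff -> : [seq w <- s | f w == f u] = [::].
  by rewrite andbT; case: (P u) (P v) => [] [].
apply/nilP; rewrite /nilp size_filter -leqn0 leqNgt -has_count.
elim: s path_s => //= w s IHs /andP[le_vw path_s].
rewrite negb_or IHs ?andbT; last first.
  by case: s path_s {IHs} => //= x s /andP[le_wx ->];
    rewrite (leK_trans _ _ _ le_vw le_wx).
by apply/eqP => eq_wu; apply: ne_vu; apply: leK_anti; rewrite le_uv -{1}eq_wu le_vw.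
Qed.

Section Trie.
Context {d : Order.disp_t} {Sigma : finOrderType d} (T : trie Sigma).
Implicit Types (u v : trie_node T).

Lemma depth_root : depth (trie_root : trie_node T) = 0.
Proof.
by rewrite /depth; case: ex_minnP => m _ /(_ 0 (eqxx _)); rewrite leqn0 => /eqP.
Qed.

Lemma depth_parent u : u != trie_root -> depth u = (depth (trie_parent u)).+1.
Proof.
move=> u_nroot; rewrite /depth; case: ex_minnP => [[|m]] /=.
  by rewrite (negPf u_nroot).
rewrite -iterS iterSr => root_m min_m; case: ex_minnP => p root_p min_p.
apply/eqP; rewrite eqSS eqn_leq min_p // andbT -ltnS min_m //.
by rewrite iterSr.
Qed.

(** Unfolds the co-lexicographic key one parent at a time, in step with the recursion of [ctx]. *)
Lemma rev_root_string u : rev (root_string u) =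
  trie_label u ::
    (if u == trie_root then [::] else rev (root_string (trie_parent u))).
Proof.
rewrite /root_string !revK; case: eqP => [->|/eqP u_nroot].
  by rewrite depth_root.
rewrite depth_parent //; set n := (depth _).+1.
have -> : iota 0 n.+1 = 0 :: map S (iota 0 n) by rewrite -(iotaDl 1 0).
rewrite map_cons -map_comp; congr (_ :: _).
by apply: eq_map => i; rewrite [LHS]/= -iterS iterSr.
Qed.

(** The label of the root occurs on no edge. *)
Lemma label_root u v : trie_label u = trie_label v ->
  (u == trie_root) = (v == trie_root).
Proof.
move=> eq_uv; case: (eqVneq u) => [u_root|u_nroot].
  apply/esym; apply: contraT => /trie_label_root_edge.
  by rewrite -eq_uv u_root eqxx.
apply/esym/negbTE; apply: contra_neq (trie_label_root_edge u_nroot).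
by rewrite eq_uv => ->.
Qed.

Lemma colex_le_ctx k u v : colex_le u v ->
  (rev (ctx k u) <= rev (ctx k v) :> seqlexi Sigma)%O.
Proof.
elim: k u v => [|k IHk] u v //.
rewrite /colex_le (rev_root_string u) (rev_root_string v) /= !rev_rcons.
rewrite !Order.SeqLexiOrder.lexi_cons.
case/andP=> le_uv /implyP le_rest; rewrite le_uv; apply/implyP => le_vu.
have eq_uv : trie_label u = trie_label v by apply: le_anti; rewrite le_uv.
move: (le_rest le_vu); rewrite (label_root eq_uv).
(* Root strings stop at the root while contexts go on repeating its label; this is harmless, as [u]
   and [v] reach the root together. *)
case: (eqVneq v) (label_root eq_uv) => [-> /eqP -> //|_ _]; exact: IHk.
Qed.

Lemma size_ctx k u : size (ctx k u) == k.
Proof. by elim: k u => [|k IHk] u //=; rewrite size_rcons eqSS. Qed.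

Lemma size_sorted_nodes : size (sorted_nodes T) = #|trie_node T|.
Proof. by rewrite size_sort -cardE. Qed.

Lemma colex_le_total : total (@colex_le _ _ T).
Proof. by move=> u v; apply: le_total. Qed.

Lemma num_runsE :
  num_runs T = \sum_(c : Sigma) runs [seq c \in out u | u <- sorted_nodes T].
Proof.
rewrite /num_runs -sum1_card.
under eq_bigl do rewrite inE.
rewrite big_mkcond /= -(pair_bigA _ (fun i c => if run_break c i then 1 else 0)).
rewrite exchange_big /=; apply: eq_bigr => c _.
rewrite runsE size_map size_sorted_nodes; apply: eq_bigr => i _.
rewrite (nth_map trie_root) ?size_sorted_nodes // /run_break.
case: eqP => [eq_n|/eqP ne_n].
  (* At the last node, the default [false] stands for the missing successor. *)
  by rewrite [nth false _ i.+1]nth_default ?size_map ?size_sorted_nodes ?eq_n //.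
have lt_n : i.+1 < #|trie_node T| by rewrite ltn_neqAle ne_n ltn_ord.
by rewrite (nth_map trie_root) ?size_sorted_nodes // /node_at; case: (_ && _).
Qed.

Lemma runs_leq_sum_cover k (c : Sigma) :
  runs [seq c \in out u | u <- sorted_nodes T] <=
  \sum_(rho : k.-tuple Sigma) runs [seq c \in A | A : {set Sigma} <- Defs.cover T rho].
Proof.
pose leK (x y : k.-tuple Sigma) := (rev x <= rev y :> seqlexi Sigma)%O.
pose f u : k.-tuple Sigma := Tuple (size_ctx k u).
have leK_trans : transitive leK by move=> x y z; apply: le_trans.
have leK_anti : antisymmetric leK.
  by move=> x y /le_anti /(can_inj revK) /val_inj.
have f_sorted : sorted (relpre f leK) (sorted_nodes T).
  apply: sub_sorted (sort_sorted colex_le_total _) => u v.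
  exact: colex_le_ctx.
apply: leq_trans (runs_leq_sum_fibers _ leK_trans leK_anti f_sorted) _.
by apply: leq_sum => rho _; rewrite /Defs.cover -map_comp.
Qed.

End Trie.

Local Open Scope ring_scope.

Lemma runs_le_log2 (R : realType) (s : seq bool) :
  (runs s)%:R <= log2 ('C(size s, count id s))%:R + 1 :> R.
Proof.
have ln2_gt0 : 0 < ln 2 :> R by rewrite ln_gt0 // ltr1n.
have bin_gt0R : 0 < ('C(size s, count id s))%:R :> R.
  by rewrite ltr0n bin_gt0 count_size.
(* Scaled by [ln 2], this is the logarithm of [exp2_runs_leq]; its factor 2 becomes the [1]. *)
rewrite /log2 -(ler_pM2r ln2_gt0) mulrDl mul1r divfK ?gt_eqF //.
rewrite mulr_natl -lnXn // -lnM ?posrE // ler_ln ?posrE ?exprn_gt0 ?mulr_gt0 //.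
by rewrite -natrX -natrM ler_nat mulnC exp2_runs_leq.
Qed.

Theorem theorem1 (R : realType) (d : Order.disp_t) (Sigma : finOrderType d)
    (T : trie Sigma) (k : nat) :
  (num_runs T)%:R <= Hwck R T k + (#|Sigma| ^ k.+1)%:R.
Proof.
have -> : (#|Sigma| ^ k.+1)%:R = \sum_(rho : k.-tuple Sigma) \sum_(c : Sigma) 1 :> R.
  by rewrite !sumr_const card_tuple -mulrnA expnS.
rewrite /Hwck -big_split num_runsE /=.
apply: (@le_trans _ _ (\sum_(c : Sigma) \sum_(rho : k.-tuple Sigma)
    runs [seq c \in A | A : {set Sigma} <- Defs.cover T rho])%:R).
  by rewrite ler_nat leq_sum // => c _; apply: runs_leq_sum_cover.
rewrite exchange_big natr_sum ler_sum // => rho _.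
rewrite /Hwc -big_split natr_sum ler_sum // => c _ /=.
by apply: le_trans (runs_le_log2 _ _) _; rewrite size_map count_map.
Qed.
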